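(* If $q\ge11$ is an odd prime power with $q\equiv2\pmod 3$, then $\mathcal W_q$ has no signing $\sigma:E(\mathcal W_q)\to\{+1,-1\}$ in which every $8$-cycle is unbalanced.
   Context: For an odd prime power $q$, $\mathcal W_q$ is the simple graph on $\mathbb F_q^4$ in which distinct vertices $v=(v_1,v_2,v_3,v_4)$ and $w=(w_1,w_2,w_3,w_4)$ are adjacent when $$w_2=-v_2+v_1w_1,\qquad w_3=-v_4+v_1^2w_1,\qquad w_4=-v_3+v_1w_1^2.$$ The sign of a cycle in a signed graph is the product of its edge signs; a cycle is unbalanced if its sign is $-1$. *)

(* Defs.v *)
From HB Require Import structures.
From mathcomp Require Import all_boot all_order all_algebra.

Set Implicit Arguments.
Unset Strict Implicit.
Unset Printing Implicit Defensive.

Import Order.TTheory GRing.Theory Num.Theory.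
Local Open Scope ring_scope.

(* A simple graph on V is a symmetric irreflexive [e : rel V]; its edges are
   the unordered pairs of adjacent vertices. *)
Definition edge_set (V : finType) (e : rel V) : {set {set V}} :=
  [set [set p.1; p.2] | p : V * V & e p.1 p.2].

(* A map E -> {+1, -1}, as a total function on {set V} of which only the values
   on edges matter. *)
Definition is_signing (V : finType) (e : rel V) (sigma : {set V} -> int) : Prop :=
  forall f : {set V}, f \in edge_set e -> sigma f = 1 \/ sigma f = -1.

(* A cycle of length n is given by a cyclic enumeration of its n distinct
   vertices; the starting point and the direction do not affect its sign. *)
Definition is_cycle (V : finType) (e : rel V) (n : nat) (c : seq V) : bool :=
  [&& (2 < n)%N, size c == n & ucycleb e c].

Definition cycle_sign (V : finType) (sigma : {set V} -> int) (c : seq V) : int :=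
  \prod_(x <- c) sigma [set x; next c x].

Definition unbalanced (V : finType) (sigma : {set V} -> int) (c : seq V) : Prop :=
  cycle_sign sigma c = -1.

(* The coordinates v_1, ..., v_4 are [v 0 0], ..., [v 0 3]. *)
Definition Wgraph (F : finFieldType) : rel 'rV[F]_4 := fun v w =>
  [&& v != w,
      w 0 1 == - v 0 1 + v 0 0 * w 0 0,
      w 0 2 == - v 0 3 + v 0 0 ^+ 2 * w 0 0
    & w 0 3 == - v 0 2 + v 0 0 * w 0 0 ^+ 2].

Lemma Wgraph_irr (F : finFieldType) : irreflexive (@Wgraph F).
Proof. by move=> v; rewrite /Wgraph eqxx. Qed.

Lemma Wgraph_sym (F : finFieldType) : symmetric (@Wgraph F).
Proof.
have flip (a b c : F) : (a == - b + c) = (b == - a + c).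
  by rewrite addrC eq_sym subr_eq addrC -subr_eq eq_sym addrC.
move=> v w; rewrite /Wgraph eq_sym; congr (_ && _).
rewrite flip [v 0 0 * w 0 0]mulrC; congr (_ && _).
rewrite flip (flip (w 0 3)) andbC.
by rewrite [v 0 0 * _]mulrC [v 0 0 ^+ 2 * _]mulrC.
Qed.

(* Main.v *)
(* For d != 0 every vertex v has exactly one neighbour with first coordinate
   v_1 + d, and v |-> this neighbour is a permutation T_d of F^4 with inverse
   T_(-d).  The walk with steps 1, -y, -y, -1, -1, y, y, 1 closes up from every
   starting vertex, and its eight first coordinates are distinct unless y is
   0, +-1, +-2 or +-1/2, so for q >= 8 a suitable y exists.  If all 8-cycles are
   unbalanced, the product of the signs of these q^4 closed walks is -1.  But
   with P(d) the product over v of the signs of the edges {v, T_d v}, so that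
   P(-d) = P(d) = +-1, the same product is P(1)^4 P(y)^4 = 1. *)
Require Import Defs.
From HB Require Import structures.
From mathcomp Require Import all_boot all_order all_algebra.
From mathcomp Require Import ring.

Set Implicit Arguments.
Unset Strict Implicit.
Unset Printing Implicit Defensive.

Import Order.TTheory GRing.Theory Num.Theory.
Local Open Scope ring_scope.

(** At [i = size p] the term [nth x p i] takes its default [x], which supplies the closing edge. *)
Lemma cycle_sign_cons (V : finType) (sigma : {set V} -> int) (x : V)
    (p : seq V) :
  uniq (x :: p) ->
  cycle_sign sigma (x :: p) =
    \prod_(i < (size p).+1) sigma [set nth x (x :: p) i; nth x p i].
Proof.
move=> Up; rewrite /cycle_sign (big_nth x) big_mkord.
apply: eq_bigr => i _; congr (sigma [set _; _]).
by rewrite next_nth mem_nth ?ltn_ord // index_uniq ?ltn_ord.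
Qed.

Lemma odd_card_natr2_neq0 (F : finFieldType) : odd #|F| -> 2%:R != 0 :> F.
Proof.
move=> oddF; apply/eqP => two0.
have : (1 : F) *+ #|F| = 0.
  (* Translation by 1 permutes [F], so adding 1 to every summand does not change the sum of all
     elements. *)
  apply: (@addrI _ (\sum_(x : F) x)); rewrite addr0 -sumr_const -big_split /=.
  by rewrite [RHS](reindex_inj (addIr 1)).
rewrite -(odd_double_half #|F|) oddF -muln2 mulrnDr mulnC mulrnA two0 mul0rn.
by rewrite addr0; apply/eqP; rewrite oner_eq0.
Qed.

Lemma exists_notin_seq (T : finType) (s : seq T) :
  (size s < #|T|)%N -> exists x, x \notin s.
Proof.
move=> lt_s; apply/existsP; apply: contraLR lt_s.
rewrite negb_exists -leqNgt => /forallP s_all.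
apply: leq_trans (card_size s); apply: subset_leq_card; apply/subsetP => x _.
by have := s_all x; rewrite negbK.
Qed.

Section Walks.

Variable F : finFieldType.
Implicit Types (v w : 'rV[F]_4) (d : F).

Definition step d v : 'rV[F]_4 :=
  \row_j [:: v 0 0 + d;
             - v 0 1 + v 0 0 * (v 0 0 + d);
             - v 0 3 + v 0 0 ^+ 2 * (v 0 0 + d);
             - v 0 2 + v 0 0 * (v 0 0 + d) ^+ 2]`_j.

Lemma step0 d v : step d v 0 0 = v 0 0 + d. Proof. by rewrite mxE. Qed.
Lemma step1 d v : step d v 0 1 = - v 0 1 + v 0 0 * (v 0 0 + d).
Proof. by rewrite mxE. Qed.
Lemma step2 d v : step d v 0 2 = - v 0 3 + v 0 0 ^+ 2 * (v 0 0 + d).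
Proof. by rewrite mxE. Qed.
Lemma step3 d v : step d v 0 3 = - v 0 2 + v 0 0 * (v 0 0 + d) ^+ 2.
Proof. by rewrite mxE. Qed.
Definition stepE := (step0, step1, step2, step3).

Lemma row4P v w :
  v 0 0 = w 0 0 -> v 0 1 = w 0 1 -> v 0 2 = w 0 2 -> v 0 3 = w 0 3 -> v = w.
Proof.
move=> e0 e1 e2 e3; apply/rowP => -[[|[|[|[|//]]]] lti].
- by move: e0; congr (v 0 _ = w 0 _); apply: val_inj.
- by move: e1; congr (v 0 _ = w 0 _); apply: val_inj.
- by move: e2; congr (v 0 _ = w 0 _); apply: val_inj.
- by move: e3; congr (v 0 _ = w 0 _); apply: val_inj.
Qed.

Lemma stepK d : cancel (step d) (step (- d)).
Proof. by move=> v; apply: row4P; rewrite !stepE; ring. Qed.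

Lemma step_adj d v : d != 0 -> Wgraph v (step d v).
Proof.
move=> d0; rewrite /Wgraph !stepE !eqxx !andbT; apply: contraNneq d0.
move/(congr1 (fun w : 'rV[F]_4 => w 0 0)).
by rewrite step0 -{1}[v 0 0]addr0 => /addrI <-.
Qed.

(** The endpoint is left out, so a closed walk does not repeat its starting vertex. *)
Fixpoint walk v (ds : seq F) : seq 'rV[F]_4 :=
  if ds is d :: ds' then v :: walk (step d v) ds' else [::].

Variable sigma : {set 'rV[F]_4} -> int.

Fixpoint walk_sign v (ds : seq F) : int :=
  if ds is d :: ds' then sigma [set v; step d v] * walk_sign (step d v) ds'
  else 1.

Definition step_sign d : int := \prod_v sigma [set v; step d v].

Lemma step_signN d : step_sign (- d) = step_sign d.
Proof.
rewrite /step_sign (reindex_inj (can_inj (stepK d))).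
by apply: eq_bigr => v _; rewrite stepK setUC.
Qed.

(** As [step d] is a bijection, the walks that remain after the first step again start exactly once
    at each vertex. *)
Lemma prod_walk_sign (ds : seq F) :
  \prod_v walk_sign v ds = \prod_(d <- ds) step_sign d.
Proof.
elim: ds => [|d ds IH]; first by rewrite big_nil big1.
rewrite big_cons -IH big_split /=; congr (_ * _).
by rewrite [RHS](reindex_inj (can_inj (stepK d))).
Qed.

Lemma step_sign_sqr d :
  is_signing (@Wgraph F) sigma -> d != 0 -> step_sign d * step_sign d = 1.
Proof.
move=> sgn d0; rewrite /step_sign -big_split big1 //= => v _.
have /sgn : [set v; step d v] \in edge_set (@Wgraph F).
  by apply/imsetP; exists (v, step d v); rewrite // inE step_adj.
by case=> ->.
Qed.

(* From a vertex with first coordinate a + y, the first coordinates visited are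
   a + y, a + 1 + y, a + 1, a + 1 - y and then their reflections in a. *)
Definition octagon (y : F) : seq F := [:: 1; - y; - y; - 1; - 1; y; y; 1].

Lemma octagon_closed (y : F) v : foldl (fun w d => step d w) v (octagon y) = v.
Proof. by apply: row4P; rewrite /= !stepE; ring. Qed.

Lemma uniq_octagon (y : F) v :
  2%:R != 0 :> F ->
  y \notin [:: 0; 1; - 1; 2%:R; - 2%:R; 2%:R^-1; - 2%:R^-1] ->
  uniq (walk v (octagon y)).
Proof.
move=> n2; rewrite !inE !negb_or => /and5P[y0 y1 yN1 y2 /and3P[yN2 yh yNh]].
(* Up to sign, any two of the eight first coordinates differ by 1, 2, [y], [2y], [1 + y], [1 - y],
   [2 + y], [2 - y], [1 + 2y], [1 - 2y], [2(1 + y)] or [2(1 - y)]. *)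
have a1 : 1 + y != 0 by rewrite addrC addr_eq0.
have a2 : 1 - y != 0 by rewrite subr_eq0 eq_sym.
have a3 : 2%:R + y != 0 by rewrite addrC addr_eq0.
have a4 : 2%:R - y != 0 by rewrite subr_eq0 eq_sym.
have a5 : 1 + 2%:R * y != 0.
  apply: contraNneq yNh => e; apply/eqP/(mulfI n2).
  by rewrite mulrN divff //; apply/eqP; rewrite -addr_eq0 addrC e.
have a6 : 1 - 2%:R * y != 0.
  apply: contraNneq yh => e; apply/eqP/(mulfI n2).
  by rewrite divff //; apply/eqP; rewrite eq_sym -subr_eq0 e.
have b1 : 2%:R * y != 0 by rewrite mulf_neq0.
have b2 : 2%:R * (1 + y) != 0 by rewrite mulf_neq0.
have b3 : 2%:R * (1 - y) != 0 by rewrite mulf_neq0.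
have b4 : 1 != 0 :> F by rewrite oner_eq0.
apply: (@map_uniq _ _ (fun w : 'rV[F]_4 => w 0 0)).
rewrite /= !inE !negb_or !stepE.
have diff (a b e : F) : e != 0 -> a - b = e -> a != b.
  by move=> e0 ab; rewrite -subr_eq0 ab.
have diffN (a b e : F) : e != 0 -> a - b = - e -> a != b.
  by move=> e0 ab; apply: (diff _ _ (- e)); rewrite ?oppr_eq0.
let by_ne h := first [by apply: (diff _ _ _ h); ring
                     | by apply: (diffN _ _ _ h); ring] in
repeat (apply/andP; split) => //;
  first [by_ne b4 | by_ne n2 | by_ne y0 | by_ne a1 | by_ne a2 | by_ne a3
        | by_ne a4 | by_ne a5 | by_ne a6 | by_ne b1 | by_ne b2 | by_ne b3].
Qed.

Lemma octagon_cycle (y : F) v :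
  y != 0 -> uniq (walk v (octagon y)) ->
  is_cycle (@Wgraph F) 8 (walk v (octagon y)).
Proof.
move=> y0 Uw.
rewrite /is_cycle /ucycleb Uw andbT /= !step_adj ?oppr_eq0 ?oner_eq0 //=.
(* The edge back to [v] is the eighth step of the walk. *)
have /= {2}<- := octagon_closed y v.
by rewrite step_adj ?oner_eq0.
Qed.

Lemma octagon_sign (y : F) v :
  uniq (walk v (octagon y)) ->
  cycle_sign sigma (walk v (octagon y)) = walk_sign v (octagon y).
Proof.
move=> Uw; rewrite cycle_sign_cons // !big_ord_recl big_ord0 /=.
by have /= -> := octagon_closed y v.
Qed.

End Walks.

Theorem proposition6p2 (F : finFieldType) (q : nat) (hF : #|F| = q)
    (hodd : odd q) (hq : (11 <= q)%N) (hmod : q = 2 %[mod 3]) :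
  ~ exists sigma : {set 'rV[F]_4} -> int,
      is_signing (@Wgraph F) sigma /\
      forall c : seq 'rV[F]_4, is_cycle (@Wgraph F) 8 c -> unbalanced sigma c.
Proof.
case=> sigma [sgn unb].
have n2 : 2%:R != 0 :> F by rewrite odd_card_natr2_neq0 ?hF.
have [|y ny] := @exists_notin_seq F
  [:: 0; 1; - 1; 2%:R; - 2%:R; 2%:R^-1; - 2%:R^-1].
  by rewrite hF (leq_trans _ hq).
have y0 : y != 0 by move: ny; rewrite inE negb_or => /andP[].
have neg v : walk_sign sigma v (octagon y) = -1.
  have Uw := uniq_octagon v n2 ny.
  by rewrite -octagon_sign //; apply/unb/octagon_cycle.
have := prod_walk_sign sigma (octagon y).
under eq_bigr do rewrite neg.
(* There are [q ^ 4] starting vertices, an odd number, so the left side is -1. *)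
rewrite prodr_const card_mx hF -signr_odd oddX hodd orbT.
rewrite !big_cons big_nil !step_signN mulr1.
have h1 := step_sign_sqr sgn (oner_neq0 F); have hy := step_sign_sqr sgn y0.
set a := step_sign sigma 1 in h1 *; set b := step_sign sigma y in hy *.
(* Each of [1] and [y] occurs four times up to sign among the steps, so the right side is a product
   of squares equal to 1. *)
have -> : a * (b * (b * (a * (a * (b * (b * a)))))) =
    (a * a) * (a * a) * ((b * b) * (b * b)) by ring.
by rewrite h1 hy.
Qed.
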